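(* Let $\Omega\subsetneq\mathbb{R}^n$ be a domain, $x\in\Omega$, $\alpha\in(0,1]$ and $C_0\ge 1$. Then the set $$S_x:=\partial^{\mathrm{str}}_{x,\alpha}\Omega\cap B\bigl(x,C_0 d_\Omega(x)\bigr)$$ is contained in a union of $N=N(\alpha,C_0,n)$ Lipschitz graphs whose Lipschitz constants are bounded by a constant depending only on $\alpha$ (here $N$ depends only on $\alpha$, $C_0$, $n$). In particular $S_x$ is $(n-1)$-rectifiable, there is a constant $C=C(\alpha,C_0,n)$ depending only on $\alpha,C_0,n$ such that $$\mathcal H^{n-1}(S_x)\le C\, d_\Omega(x)^{n-1},$$ and $$\mathcal H^\lambda_\infty(S_x)=0\qquad\text{for every }\lambda>n-1 .$$
   Context: A domain is a nonempty connected open set. $d_\Omega(y):=\operatorname{dist}(y,\partial\Omega)$ for $y\in\Omega$; $B(y,r)$ is the open ball. For $x\ne\xi$, $[x,\xi):=\{(1-t)x+t\xi:0\le t<1\}$. For $x\in\Omega$ and $\alpha\in(0,1]$, the quantitatively straight visible boundary is $$\partial^{\mathrm{str}}_{x,\alpha}\Omega:=\bigl\{\xi\in\partial\Omega:\ [x,\xi)\subset\Omega\ \text{ and }\ d_\Omega((1-t)x+t\xi)\ge\alpha\min\{t,1-t\}|x-\xi|\ \text{ for every }t\in(0,1)\bigr\}.$$ $\mathcal H^{s}$ is $s$-dimensional Hausdorff measure, and the $\lambda$-Hausdorff content of $E\subset\mathbb{R}^n$ is $\mathcal H^\lambda_\infty(E):=\inf\{\sum_i r_i^\lambda: E\subset\bigcup_i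 B(x_i,r_i)\}$, the infimum over (at most) countable covers by balls. A Lipschitz graph is the graph $\{w+f(w)v: w\in A\}$ of a Lipschitz function $f:A\to\mathbb{R}$ defined on a subset $A$ of a hyperplane $v^\perp$, for some unit vector $v$. *)

(* Defs.v *)
From HB Require Import structures.
From mathcomp Require Import all_boot all_order all_algebra.
From mathcomp Require Import all_classical all_reals all_analysis.

Set Implicit Arguments.
Unset Strict Implicit.
Unset Printing Implicit Defensive.

Import Order.TTheory GRing.Theory Num.Theory.
Import numFieldNormedType.Exports.

Local Open Scope classical_set_scope.
Local Open Scope ring_scope.

(* R^n is 'rV[R]_n. The library norm and balls of 'rV[R]_n are those of the sup
   norm; every metric notion below uses the Euclidean norm instead. The
   topology is the same, so open, connected, closure and interior are the
   library's. *)

Definition dotv (R : realType) (n : nat) (u v : 'rV[R]_n) : R :=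
  \sum_(i < n) u 0 i * v 0 i.

Definition enorm (R : realType) (n : nat) (u : 'rV[R]_n) : R :=
  Num.sqrt (dotv u u).

Definition eball (R : realType) (n : nat) (x : 'rV[R]_n) (r : R) :
    set 'rV[R]_n :=
  [set y | enorm (y - x) < r].

Definition domain (R : realType) (n : nat) (Omega : set 'rV[R]_n) : Prop :=
  [/\ Omega !=set0, open Omega & connected Omega].

Definition bdry (R : realType) (n : nat) (E : set 'rV[R]_n) : set 'rV[R]_n :=
  closure E `\` interior E.

(* A real infimum: junk value 0 if the boundary is empty, which happens for no
   domain other than the whole space. *)
Definition dbdry (R : realType) (n : nat) (Omega : set 'rV[R]_n)
    (y : 'rV[R]_n) : R :=
  inf [set enorm (y - z) | z in bdry Omega].

Definition seg (R : realType) (n : nat) (x xi : 'rV[R]_n) (t : R) : 'rV[R]_n :=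
  (1 - t) *: x + t *: xi.

Definition str_bdry (R : realType) (n : nat) (Omega : set 'rV[R]_n)
    (x : 'rV[R]_n) (alpha : R) : set 'rV[R]_n :=
  [set xi | [/\ bdry Omega xi,
      (forall t : R, 0 <= t < 1 -> Omega (seg x xi t)) &
      (forall t : R, 0 < t < 1 ->
         alpha * Num.min t (1 - t) * enorm (x - xi)
           <= dbdry Omega (seg x xi t))]].

(* At most countable covers are indexed by a set I of naturals, so that finite
   and empty covers need no padding by degenerate sets. *)

Definition hausdorff_content (R : realType) (n : nat) (lambda : R)
    (E : set 'rV[R]_n) : \bar R :=
  ereal_inf [set s | exists (I : set nat) (c : nat -> 'rV[R]_n) (r : nat -> R),
    [/\ (forall i, I i -> 0 < r i),
        E `<=` \bigcup_(i in I) eball (c i) (r i) &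
        s = \esum_(i in I) ((r i) `^ lambda)%:E]].

Definition ediam (R : realType) (n : nat) (U : set 'rV[R]_n) : \bar R :=
  ereal_sup [set (enorm (u - v))%:E | u in U & v in U].

(* The covering sets are nonempty and 0 `^ 0 = 1, so that the 0-dimensional
   measure is the counting measure. No dimensional normalizing factor. *)
Definition hausdorff_pre (R : realType) (n : nat) (s delta : R)
    (E : set 'rV[R]_n) : \bar R :=
  ereal_inf [set a | exists (I : set nat) (U : nat -> set 'rV[R]_n),
    [/\ (forall i, I i -> U i !=set0 /\ (ediam (U i) <= delta%:E)%E),
        E `<=` \bigcup_(i in I) U i &
        a = \esum_(i in I) (ediam (U i) `^ s)%E]].

Definition hausdorff_measure (R : realType) (n : nat) (s : R)
    (E : set 'rV[R]_n) : \bar R :=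
  ereal_sup [set hausdorff_pre s delta E | delta in [set delta : R | 0 < delta]].

Definition lipschitz_graph (R : realType) (n : nat) (L : R)
    (G : set 'rV[R]_n) : Prop :=
  exists (v : 'rV[R]_n) (A : set 'rV[R]_n) (f : 'rV[R]_n -> R),
    [/\ enorm v = 1,
        A `<=` [set w | dotv w v = 0],
        (forall w w', A w -> A w' -> `|f w - f w'| <= L * enorm (w - w')) &
        G = [set w + f w *: v | w in A]].

(* E is covered, up to an H^m-null set, by countably many Lipschitz images of
   R^m. *)
Definition rectifiable (R : realType) (n m : nat) (E : set 'rV[R]_n) : Prop :=
  exists g : nat -> 'rV[R]_m -> 'rV[R]_n,
    (forall k, exists L : R, forall u u',
       enorm (g k u - g k u') <= L * enorm (u - u')) /\
    hausdorff_measure m%:R (E `\` \bigcup_k range (g k)) = 0%E.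

(* Main.v *)
Require Import Defs.
From HB Require Import structures.
From mathcomp Require Import all_boot all_order all_algebra.
From mathcomp Require Import all_classical all_reals all_analysis.
From mathcomp Require Import ring lra.

Set Implicit Arguments.
Unset Strict Implicit.
Unset Printing Implicit Defensive.

Import Order.TTheory GRing.Theory Num.Theory.
Import numFieldNormedType.Exports.

Local Open Scope classical_set_scope.
Local Open Scope ring_scope.

(** Write [d] for the distance from [x] to the boundary. If [xi] is a straight
visible boundary point, then on the half of the segment from [xi] to [x] that is
adjacent to [xi], the point at distance [s] from [xi] is the centre of a ball of
radius [alpha * s] that contains no boundary point. These balls fill a cone with
vertex [xi], axis [x - xi], opening controlled by [alpha] and height at least
[d / 2], and no boundary point lies in it ([str_bdry_cone]).

Cut the set into pieces of diameter at most [alpha / 4 * d], using a grid of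
cubes whose number depends on [alpha], [C0] and [n] only. Inside a piece all
points see [x] in nearly the same direction [v], so the cones, slightly
narrowed, share the axis [v], and they are tall compared with the piece. Two
points of the piece avoid each other's cones, that is, the segment joining them
makes an angle with [v] that is bounded below: the piece is a graph over the
hyperplane orthogonal to [v], with Lipschitz constant [2 / alpha]
([cone_graph_like], [str_bdry_split]).

Everything else follows from the graph structure. Dropping the coordinate in
which [v] is largest is bi-Lipschitz on that hyperplane, with constants that do
not depend on [v]; hence each piece has a 1-Lipschitz chart into the space of
dimension [n - 1] whose inverse is Lipschitz with a uniform constant
([graph_like_chart]). The McShane extension of the inverse chart gives
rectifiability ([has_chart_rectifiable]). A grid of [M ^ (n - 1)] cubes in the
chart gives, for every [M], a cover of the piece by as many sets of diameter
[O(d / M)] ([has_chart_box_covered]); the sum of their diameters to the power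
[n - 1] is bounded by a multiple of [d ^ (n - 1)] independently of [M], and to
any larger power it tends to zero as [M] grows ([box_covered_measure],
[box_covered_content]). *)

(** * The Euclidean norm *)

Section Euclid.
Context {R : realType} {n : nat}.
Implicit Types (u v w : 'rV[R]_n) (a : R).

Lemma dotvC u v : dotv u v = dotv v u.
Proof. by apply: eq_bigr => i _; rewrite mulrC. Qed.

Lemma dotvDl u v w : dotv (u + v) w = dotv u w + dotv v w.
Proof. by rewrite -big_split; apply: eq_bigr => i _; rewrite mxE mulrDl. Qed.

Lemma dotvZl a u w : dotv (a *: u) w = a * dotv u w.
Proof. by rewrite /dotv big_distrr; apply: eq_bigr => i _; rewrite mxE /= mulrA. Qed.

Lemma dotvNl u w : dotv (- u) w = - dotv u w.
Proof. by rewrite -scaleN1r dotvZl mulN1r. Qed.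

Lemma dotvDr u v w : dotv w (u + v) = dotv w u + dotv w v.
Proof. by rewrite dotvC dotvDl !(dotvC w). Qed.

Lemma dotvZr a u w : dotv w (a *: u) = a * dotv w u.
Proof. by rewrite dotvC dotvZl (dotvC w). Qed.

Lemma dotvNr u w : dotv w (- u) = - dotv w u.
Proof. by rewrite dotvC dotvNl (dotvC w). Qed.

Definition dotvE := (dotvDl, dotvDr, dotvNl, dotvNr, dotvZl, dotvZr).

Lemma dotv_ge0 u : 0 <= dotv u u.
Proof. by apply: sumr_ge0 => i _; rewrite -expr2 sqr_ge0. Qed.

Lemma enorm_ge0 u : 0 <= enorm u.
Proof. exact: sqrtr_ge0. Qed.

Lemma sqr_enorm u : enorm u ^+ 2 = dotv u u.
Proof. by rewrite sqr_sqrtr ?dotv_ge0. Qed.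

Lemma enorm_le u a : 0 <= a -> dotv u u <= a ^+ 2 -> enorm u <= a.
Proof. by move=> a0 ua; rewrite -(ler_pXn2r (n:=2)) ?nnegrE ?enorm_ge0// sqr_enorm. Qed.

Lemma ler_coord_enorm u i : `|u 0 i| <= enorm u.
Proof.
rewrite -sqrtr_sqr ler_sqrt ?dotv_ge0// /dotv (bigD1 i)//= expr2 lerDl.
by apply: sumr_ge0 => j _; rewrite -expr2 sqr_ge0.
Qed.

Lemma enorm_eq0 u : enorm u = 0 -> u = 0.
Proof.
move=> u0; apply/rowP => i; rewrite mxE; apply/eqP.
by rewrite -normr_le0 -u0 ler_coord_enorm.
Qed.

Lemma enorm0 : enorm (0 : 'rV[R]_n) = 0.
Proof. by rewrite /enorm /dotv big1 ?sqrtr0// => i _; rewrite mxE mul0r. Qed.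

Lemma enormZ a u : enorm (a *: u) = `|a| * enorm u.
Proof. by rewrite /enorm !dotvE mulrA -expr2 sqrtrM ?sqr_ge0// sqrtr_sqr. Qed.

Lemma enormN u : enorm (- u) = enorm u.
Proof. by rewrite -scaleN1r enormZ normrN1 mul1r. Qed.

Lemma enormB u v : enorm (u - v) = enorm (v - u).
Proof. by rewrite -enormN opprB. Qed.

Lemma cauchy_schwarz u v : dotv u v <= enorm u * enorm v.
Proof.
have [/eqP u0|u0] := boolP (enorm u == 0).
  by rewrite u0 mul0r (enorm_eq0 u0) -(scale0r 0) dotvZl mul0r.
have [/eqP v0|v0] := boolP (enorm v == 0).
  by rewrite v0 mulr0 (enorm_eq0 v0) -(scale0r 0) dotvZr mul0r.
have uv : 0 < enorm u * enorm v by rewrite mulr_gt0// lt0r ?u0 ?v0 enorm_ge0.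
have := dotv_ge0 (enorm v *: u - enorm u *: v).
rewrite !dotvE -!sqr_enorm (dotvC v u) => h.
have {}h : 0 <= enorm u * enorm v * (enorm u * enorm v - dotv u v) by lra.
by rewrite pmulr_rge0// subr_ge0 in h.
Qed.

Lemma ler_enormD u v : enorm (u + v) <= enorm u + enorm v.
Proof.
apply: enorm_le; first by rewrite addr_ge0 ?enorm_ge0.
rewrite !dotvE (dotvC v u) -!sqr_enorm.
by have := cauchy_schwarz u v; lra.
Qed.

Lemma ler_enorm_dist u v w : enorm (u - w) <= enorm (u - v) + enorm (v - w).
Proof. by rewrite -{1}(subrK v u) -addrA ler_enormD. Qed.

Lemma ler_enorm_sum u : enorm u <= \sum_i `|u 0 i|.
Proof.
apply: enorm_le; first by apply: sumr_ge0.
rewrite expr2 /dotv big_distrl ler_sum//= => i _.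
rewrite -expr2 -real_normK ?num_real// expr2 ler_wpM2l//.
by rewrite (bigD1 i)//= lerDl sumr_ge0.
Qed.

(** This is the orthogonal projection onto the complement of [v] only when [v]
is a unit vector. *)
Definition hproj v u : 'rV[R]_n := u - dotv u v *: v.

Lemma hprojK v u : hproj v u + dotv u v *: v = u.
Proof. by rewrite subrK. Qed.

Lemma hprojB v u w : hproj v (u - w) = hproj v u - hproj v w.
Proof. by apply/rowP => i; rewrite /hproj !dotvE !mxE; ring. Qed.

Lemma dotv_hproj v u : enorm v = 1 -> dotv (hproj v u) v = 0.
Proof. by move=> v1; rewrite /hproj !dotvE -sqr_enorm v1 expr1n mulr1 subrr. Qed.

Lemma pythagoras v u : enorm v = 1 ->
  enorm u ^+ 2 = enorm (hproj v u) ^+ 2 + dotv u v ^+ 2.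
Proof.
move=> v1; rewrite !sqr_enorm /hproj !dotvE -(sqr_enorm v) v1 (dotvC v u).
by ring.
Qed.

Lemma ler_hproj v u : enorm v = 1 -> enorm (hproj v u) <= enorm u.
Proof.
move=> v1; rewrite -(ler_pXn2r (n:=2)) ?nnegrE ?enorm_ge0//.
by rewrite (pythagoras u v1) lerDl sqr_ge0.
Qed.

Lemma ler_dotv_unit v u : enorm v = 1 -> `|dotv u v| <= enorm u.
Proof.
move=> v1; rewrite -(ler_pXn2r (n:=2)) ?nnegrE ?enorm_ge0//.
by rewrite real_normK ?num_real// (pythagoras u v1) lerDr sqr_ge0.
Qed.

End Euclid.

(** * Grids *)

Lemma sumr_le_const (R : realType) (k : nat) (F : 'I_k -> R) (c : R) :
  (forall i, F i <= c) -> \sum_i F i <= k%:R * c.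
Proof.
move=> Fc; have -> : k%:R * c = \sum_(i < k) c.
  by rewrite sumr_const card_ord mulr_natl.
exact: ler_sum.
Qed.

(** A box of side [l] splits into [M ^ k] half-open subcubes. The cells are
labelled by a map rather than given as sets, so that one application serves both
for cutting a set in space and for cutting it in the domain of a chart. *)
Lemma vec_grid (R : realType) (T : Type) (k M : nat) (E : set T)
    (phi : T -> 'I_k -> R) (a : 'I_k -> R) (l : R) :
  (0 < M)%N -> 0 < l ->
  (forall y, E y -> forall i, a i <= phi y i < a i + l) ->
  exists c : T -> 'I_(M ^ k), forall y z, E y -> E z -> c y = c z ->
    forall i, `|phi y i - phi z i| <= l / M%:R.
Proof.
case: M => // M _ l0 hE.
pose q y i := (phi y i - a i) / l * M.+1%:R.
pose c y : {ffun 'I_k -> 'I_M.+1} := [ffun i => inord (Num.truncn (q y i))].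
have cardE : #|{ffun 'I_k -> 'I_M.+1}| = (M.+1 ^ k)%N.
  by rewrite card_ffun !card_ord.
exists (fun y => cast_ord cardE (enum_rank (c y))) => y z Ey Ez.
move=> /cast_ord_inj/enum_rank_inj/ffunP cyz i.
have qb w : E w -> 0 <= q w i < M.+1%:R.
  move=> /hE/(_ i)/andP[h1 h2]; apply/andP; split.
    by rewrite !mulr_ge0 ?invr_ge0 ?subr_ge0// ltW.
  by rewrite gtr_pMl// ltr_pdivrMr// mul1r; lra.
have tr w : E w -> (Num.truncn (q w i) < M.+1)%N.
  by move=> /qb/andP[? ?]; rewrite truncn_lt_nat.
move: (cyz i); rewrite !ffunE => /(congr1 (@nat_of_ord _)).
rewrite !inordK ?tr// => tE.
have /andP[/truncn_itv/andP[y1 y2] _] := qb _ Ey.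
have /andP[/truncn_itv/andP[z1 z2] _] := qb _ Ez.
rewrite tE -natr1 in y1 y2; rewrite -natr1 in z2.
have -> : phi y i - phi z i = l / M.+1%:R * (q y i - q z i).
  have M0 : M.+1%:R != 0 :> R by rewrite pnatr_eq0.
  move: M0; rewrite /q; move: (M.+1%:R : R) => m M0; field.
  by rewrite M0 gt_eqF.
have lM : 0 < l / M.+1%:R by rewrite divr_gt0// ltr0n.
rewrite normrM (gtr0_norm lM) ger_pMr// ler_norml; lra.
Qed.

(** * Graphs over a hyperplane and their charts *)

(** Any two points of [E] are joined by a segment of slope at most [L] over the
hyperplane orthogonal to [v]: the form in which the cone condition produces
Lipschitz graphs. *)
Definition graph_like (R : realType) (n : nat) (L : R) (v : 'rV[R]_n)
    (E : set 'rV[R]_n) : Prop :=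
  forall y z, E y -> E z -> `|dotv (y - z) v| <= L * enorm (hproj v (y - z)).

Lemma graph_like_lipschitz (R : realType) (n : nat) (L : R) (v : 'rV[R]_n)
    (E : set 'rV[R]_n) :
  enorm v = 1 -> graph_like L v E -> lipschitz_graph L E.
Proof.
move=> v1 vE; pose sel w := xget 0 [set y | E y /\ hproj v y = w].
have selP y : E y ->
    E (sel (hproj v y)) /\ hproj v (sel (hproj v y)) = hproj v y.
  move=> Ey; apply: (xgetPex 0 (P := [set z | E z /\ hproj v z = hproj v y])).
  by exists y.
pose f w := dotv (sel w) v; exists v, (hproj v @` E), f; split=> //.
- by move=> _ [y _ <-]; exact: dotv_hproj.
- move=> _ _ [y Ey <-] [z Ez <-].
  have [[Ey' <-] [Ez' <-]] := (selP _ Ey, selP _ Ez); rewrite -hprojB.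
  have [_ ye] := selP _ Ey'; have [_ ze] := selP _ Ez'.
  have [_ ye0] := selP _ Ey; have [_ ze0] := selP _ Ez.
  rewrite /f ye0 ze0 -dotvNl -dotvDl; exact: vE.
have fE y : E y -> f (hproj v y) = dotv y v.
  move=> Ey; have [Es sy] := selP _ Ey; apply/eqP.
  rewrite /f -subr_eq0 -normr_le0 -dotvNl -dotvDl (le_trans (vE _ _ Es Ey))//.
  by rewrite hprojB sy subrr enorm0 mulr0.
apply/seteqP; split=> [y Ey|_ [_ [y Ey <-] <-]].
  by exists (hproj v y); [exists y | rewrite fE// hprojK].
by rewrite fE// hprojK.
Qed.

(** Solving the orthogonality relation for the largest coordinate of [v] divides
by the largest coefficient, so the bound does not depend on [v]. *)
Lemma orthogonal_max_coord (R : realType) (m : nat) (z v : 'rV[R]_m.+1) j :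
  v != 0 -> dotv z v = 0 -> (forall i, `|v 0 i| <= `|v 0 j|) ->
  `|z 0 j| <= \sum_i `|z 0 (lift j i)|.
Proof.
move=> v0 zv vmax.
have vj : 0 < `|v 0 j|.
  rewrite lt0r normr_ge0 andbT; apply: contra v0 => /eqP vj0.
  by apply/eqP/rowP => i; rewrite mxE; apply/eqP; rewrite -normr_le0 -vj0.
rewrite -(ler_pM2r vj) -normrM.
have -> : z 0 j * v 0 j = - \sum_i z 0 (lift j i) * v 0 (lift j i).
  by apply/eqP; rewrite -addr_eq0; move: zv; rewrite /dotv (bigD1_ord j)//= => ->.
rewrite normrN mulr_suml (le_trans (ler_norm_sum _ _ _))// ler_sum// => i _.
by rewrite normrM ler_wpM2l.
Qed.

(** The first condition is required on the whole space, where the projections used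
below satisfy it; only the expansion estimate uses [E]. The sum of coordinates
in place of a norm on the target suits both the grids and the bound of
[orthogonal_max_coord]. *)
Definition has_chart (R : realType) (m n : nat) (K : R) (E : set 'rV[R]_n) :=
  exists T : 'rV[R]_n -> 'rV[R]_m,
    (forall y z i, `|T y 0 i - T z 0 i| <= enorm (y - z)) /\
    (forall y z, E y -> E z -> enorm (y - z) <= K * \sum_i `|T y 0 i - T z 0 i|).

(** The chart projects along [v] and then drops the coordinate in which [v] is
largest. Dropping it at most halves the sum of the coordinates of a vector
orthogonal to [v], and undoing the projection costs a factor [1 + L]. *)
Lemma graph_like_chart (R : realType) (m : nat) (L : R) (v : 'rV[R]_m.+1)
    (E : set 'rV[R]_m.+1) :
  0 <= L -> enorm v = 1 -> graph_like L v E -> has_chart m (2 * (1 + L)) E.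
Proof.
move=> L0 v1 vE; have v0 : v != 0.
  by apply/eqP => v0; have := @enorm0 R m.+1; rewrite -v0 v1; apply/eqP/oner_neq0.
have [j vmax] : exists j, forall i, `|v 0 i| <= `|v 0 j|.
  have [j _ jmax] := arg_maxP (fun i => `|v 0 i|) (isT : xpredT (ord0 : 'I_m.+1)).
  by exists j => i; exact: jmax.
exists (fun y => col' j (hproj v y)).
have TE y z i : col' j (hproj v y) 0 i - col' j (hproj v z) 0 i =
    hproj v (y - z) 0 (lift j i).
  by rewrite hprojB !mxE.
split=> [y z i|y z Ey Ez].
  by rewrite TE (le_trans (ler_coord_enorm _ _))// ler_hproj.
under eq_bigr do rewrite TE.
set w := hproj v (y - z).
have w2 : enorm w <= 2 * \sum_i `|w 0 (lift j i)|.
  rewrite (le_trans (ler_enorm_sum _))// (bigD1_ord j)//= mulr_natl mulr2n lerD2r.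
  exact: (orthogonal_max_coord v0 (dotv_hproj _ v1)).
have : enorm (y - z) <= (1 + L) * enorm w.
  rewrite -[X in enorm X](hprojK v) -/w (le_trans (ler_enormD _ _))//.
  by rewrite enormZ v1 mulr1 mulrDl mul1r lerD2l; exact: vE.
move=> /le_trans; apply; rewrite [2 * _]mulrC -mulrA ler_wpM2l//; lra.
Qed.

(** * Rectifiability *)

(** The extension is the largest one with this Lipschitz constant: the infimum
over [y] in [E] of the cones [f y + K * enorm (u - p y)]. Stated for a function
[f] and a map [p] on the same set, it extends [f \o p^-1] without naming the
inverse. *)
Lemma mcshane_extension (R : realType) (T : Type) (m : nat) (K : R)
    (E : set T) (p : T -> 'rV[R]_m) (f : T -> R) :
  0 <= K -> E !=set0 ->
  (forall y z, E y -> E z -> f y - f z <= K * enorm (p y - p z)) ->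
  exists F : 'rV[R]_m -> R,
    (forall u w, `|F u - F w| <= K * enorm (u - w)) /\
    (forall y, E y -> F (p y) = f y).
Proof.
move=> K0 [y0 Ey0] fE.
pose D u := [set f y + K * enorm (u - p y) | y in E].
have Dlb u z : E z -> lbound (D u) (f z - K * enorm (u - p z)).
  move=> Ez _ [y Ey <-]; have := fE _ _ Ez Ey.
  have := ler_wpM2l K0 (ler_enorm_dist (p z) u (p y)).
  by rewrite mulrDr (enormB (p z) u); lra.
have D0 u : D u !=set0 by exists (f y0 + K * enorm (u - p y0)), y0.
have Dinf u y : E y -> inf (D u) <= f y + K * enorm (u - p y).
  move=> Ey; apply: ge_inf; last by exists y.
  by exists (f y0 - K * enorm (u - p y0)); exact: Dlb.
exists (fun u => inf (D u)); split=> [u w|y Ey]; last first.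
  apply/le_anti/andP; split.
    by rewrite (le_trans (Dinf _ _ Ey))// subrr enorm0 mulr0 addr0.
  apply: lb_le_inf => //; have := Dlb (p y) _ Ey.
  by rewrite subrr enorm0 mulr0 subr0.
have up a b : inf (D a) <= inf (D b) + K * enorm (a - b).
  rewrite -lerBlDr; apply: lb_le_inf => // _ [y Ey <-].
  have := Dinf a _ Ey; have := ler_wpM2l K0 (ler_enorm_dist a b (p y)).
  by rewrite mulrDr; lra.
have := up u w; have := up w u; rewrite (enormB w u) ler_norml; lra.
Qed.

(** Apply McShane to each coordinate of the inverse of the chart. *)
Lemma has_chart_param (R : realType) (m n : nat) (K : R) (E : set 'rV[R]_n) :
  0 <= K -> has_chart m K E ->
  exists g : 'rV[R]_m -> 'rV[R]_n,
    (exists L, forall u w, enorm (g u - g w) <= L * enorm (u - w)) /\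
    E `<=` range g.
Proof.
move=> K0 [T [_ TE]].
have [[y0 Ey0]|/nonemptyPn ->] := pselect (E !=set0); last first.
  exists (fun=> 0); split=> //; exists 0 => u w.
  by rewrite subrr enorm0 mul0r.
have Km : 0 <= K * m%:R by rewrite mulr_ge0.
have hF i : exists F : 'rV[R]_m -> R,
    (forall u w, `|F u - F w| <= K * m%:R * enorm (u - w)) /\
    (forall y, E y -> F (T y) = y 0 i).
  apply: mcshane_extension => //; first by exists y0.
  move=> y z Ey Ez; have := ler_coord_enorm (y - z) i; rewrite !mxE => h.
  rewrite (le_trans (ler_norm _))// (le_trans h)// (le_trans (TE _ _ Ey Ez))//.
  rewrite -mulrA ler_wpM2l// sumr_le_const// => k.
  by have := ler_coord_enorm (T y - T z) k; rewrite !mxE.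
have /choice[F FP] := hF.
exists (fun u => \row_i F i u); split.
  exists (n%:R * (K * m%:R)) => u w.
  rewrite (le_trans (ler_enorm_sum _))// -mulrA sumr_le_const// => i.
  by rewrite !mxE; exact: (FP i).1.
move=> y Ey; exists (T y) => //; apply/rowP => i.
by rewrite mxE (FP i).2.
Qed.

(** * Hausdorff measure and content from efficient covers *)

(** The quantitative form of having upper box dimension at most [m]: at each scale
[D / M], about [M ^ m] sets suffice. The factor [N] counts pieces. *)
Definition box_covered (R : realType) (n m N : nat) (D : R) (E : set 'rV[R]_n) :=
  forall M, (0 < M)%N -> exists U : 'I_(N * M ^ m) -> set 'rV[R]_n,
    E `<=` \bigcup_p U p /\
    forall p y z, U p y -> U p z -> enorm (y - z) <= D / M%:R.

Lemma esum_nat_le (R : realType) (I : set nat) (k : nat) (a : nat -> \bar R)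
    (c : R) :
  (forall i, I i -> (i < k)%N) -> 0 <= c ->
  (forall i, I i -> (0 <= a i <= c%:E)%E) ->
  (\esum_(i in I) a i <= (k%:R * c)%:E)%E.
Proof.
move=> Ik c0 aI; rewrite esum_mkcond.
have -> : (\esum_(i in [set: nat]) (if i \in I then a i else 0%E) =
   \esum_(i in `I_k) (if i \in I then a i else 0%E))%E.
  rewrite [RHS]esum_mkcond; apply: eq_esum => i _.
  by case: ifPn => [iI|_]; [rewrite ifT//; exact/mem_set/Ik/set_mem | case: ifP].
rewrite esum_fset//; last first.
  by move=> i _; case: ifPn => // iI; have /andP[] := aI _ (set_mem iI).
rewrite -fsbig_ord (@le_trans _ _ (\sum_(i < k) c%:E)%E)//.
  apply: lee_sum => i _; case: ifPn => [iI|_].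
    by have /andP[] := aI _ (set_mem iI).
  by rewrite lee_fin.
by rewrite sumEFin sumr_const card_ord mulr_natl.
Qed.

(** Covers in the definitions of Hausdorff measure and content are indexed by
sets of naturals and consist of nonempty sets, so the empty cells are dropped
from the index set. *)
Lemma box_covered_nat (R : realType) (n m N M : nat) (D : R) (E : set 'rV[R]_n) :
  box_covered m N D E -> (0 < M)%N ->
  exists (I : set nat) (V : nat -> set 'rV[R]_n),
    [/\ forall i, I i -> (i < N * M ^ m)%N, forall i, I i -> V i !=set0,
        E `<=` \bigcup_(i in I) V i &
        forall i y z, V i y -> V i z -> enorm (y - z) <= D / M%:R].
Proof.
move=> cE /cE[U [EU dU]].
pose V i := [set y | exists2 p, nat_of_ord p = i & U p y].
exists [set i | V i !=set0], V; split=> //.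
- by move=> _ [y [p <- _]].
- move=> y /EU[p _ Upy]; exists (nat_of_ord p); last by exists p.
  by exists y, p.
- by move=> _ y z [p <- Uy] [q /ord_inj -> Uz]; exact: dU Uy Uz.
Qed.

Lemma ediam_ge0 (R : realType) (n : nat) (U : set 'rV[R]_n) :
  U !=set0 -> (0 <= ediam U)%E.
Proof.
move=> [y Uy]; apply: ereal_sup_ubound; exists y => //; exists y => //.
by rewrite subrr enorm0.
Qed.

Lemma hausdorff_pre_ge0 (R : realType) (n : nat) (s delta : R) (E : set 'rV[R]_n) :
  (0 <= hausdorff_pre s delta E)%E.
Proof.
apply: le_ereal_inf_tmp => _ [I [U [_ _ ->]]].
by apply: esum_ge0 => i _; exact: poweR_ge0.
Qed.

Lemma hausdorff_content_ge0 (R : realType) (n : nat) (lambda : R) (E : set 'rV[R]_n) :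
  (0 <= hausdorff_content lambda E)%E.
Proof.
apply: le_ereal_inf_tmp => _ [I [c [r [_ _ ->]]]].
by apply: esum_ge0 => i _; rewrite lee_fin powR_ge0.
Qed.

(** With [N * M ^ m] sets of diameter at most [D / M], the sum of the [m]-th powers
is at most [N * D ^ m] whatever [M] is, so [M] can be taken as large as the
restriction to small diameters demands. *)
Lemma box_covered_measure (R : realType) (n m N : nat) (D : R) (E : set 'rV[R]_n) :
  0 <= D -> box_covered m N D E ->
  (hausdorff_measure m%:R E <= (N%:R * D ^+ m)%:E)%E.
Proof.
move=> D0 cE; apply: ge_ereal_sup => _ [delta /= delta0 <-].
pose M := (Num.truncn (D / delta)).+1.
have M0 : 0 < M%:R :> R by rewrite ltr0n.
have DM : D / M%:R <= delta.
  rewrite ler_pdivrMr// mulrC -ler_pdivrMr//; apply/ltW.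
  exact: truncnS_gt.
have [I [V [Ik V0 EV dV]]] := box_covered_nat cE (ltn0Sn _ : (0 < M)%N).
have dVM i : I i -> (ediam (V i) <= (D / M%:R)%:E)%E.
  move=> Ii; apply: ge_ereal_sup => _ [y Vy [z Vz <-]].
  by rewrite lee_fin; exact: dV Vy Vz.
have DM0 : 0 <= D / M%:R by rewrite divr_ge0// ltW.
apply: (@le_trans _ _ (\esum_(i in I) (ediam (V i) `^ m%:R)%E)).
  apply: ereal_inf_lbound; exists I, V; split=> // i Ii; split; first exact: V0.
  by apply: (le_trans (dVM _ Ii)); rewrite lee_fin.
have -> : N%:R * D ^+ m = (N * M ^ m)%:R * (D / M%:R) ^+ m.
  rewrite natrM natrX expr_div_n -mulrA; congr (_ * _).
  by rewrite mulrCA mulfV ?mulr1// expf_neq0// gt_eqF.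
apply: esum_nat_le => //; first exact: exprn_ge0.
move=> i Ii; rewrite poweR_ge0/= -powR_mulrn// -poweR_EFin.
apply: gt0_ler_poweR;
  rewrite ?in_itv/= ?ler0n ?leey ?andbT ?lee_fin ?ediam_ge0 ?dVM//.
exact: V0.
Qed.

Lemma box_covered0 (R : realType) (n m : nat) (D : R) :
  box_covered m 0 D (set0 : set 'rV[R]_n).
Proof. by move=> M _; exists (fun=> set0); split=> // y. Qed.

Lemma hausdorff_measure0 (R : realType) (n m : nat) :
  hausdorff_measure m%:R (set0 : set 'rV[R]_n) = 0%E.
Proof.
apply/le_anti/andP; split.
  have := @box_covered_measure R n m 0 0 set0 (lexx _).
  by rewrite mul0r; apply; exact: box_covered0.
apply: (le_trans (hausdorff_pre_ge0 m%:R 1 set0)).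
by apply: ereal_sup_ubound; exists 1 => //=; exact: ltr01.
Qed.

(** The same cover now has sum of order [M `^ (m - lambda)], which tends to zero. *)
Lemma box_covered_content (R : realType) (n m N : nat) (D lambda : R) (E : set 'rV[R]_n) :
  0 < D -> m%:R < lambda -> box_covered m N D E ->
  hausdorff_content lambda E = 0%E.
Proof.
move=> D0 ml cE; apply/le_anti; rewrite hausdorff_content_ge0 andbT.
apply/lee_addgt0Pr => e e0; rewrite add0e.
have lm : 0 < lambda - m%:R by rewrite subr_gt0.
pose c := N%:R * (2 * D) `^ lambda.
have c0 : 0 <= c by rewrite mulr_ge0// powR_ge0.
(* [M] is chosen so that [c / M `^ (lambda - m) <= e], where the left
   side bounds the sum for balls of radius [2 * D / M]. *)
pose M := (Num.truncn ((c / e) `^ (lambda - m%:R)^-1)).+1.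
have M0 : 0 < M%:R :> R by rewrite ltr0n.
have cM : c / M%:R `^ (lambda - m%:R) <= e.
  rewrite ler_pdivrMr ?powR_gt0// mulrC -ler_pdivrMr//.
  have ce : 0 <= c / e by rewrite divr_ge0// ltW.
  have -> : c / e = ((c / e) `^ (lambda - m%:R)^-1) `^ (lambda - m%:R).
    by rewrite -powRrM mulVf ?gt_eqF// powRr1.
  apply: ge0_ler_powR; rewrite ?nnegrE ?powR_ge0 ?(ltW lm) ?(ltW M0)//.
  exact/ltW/truncnS_gt.
have [I [V [Ik V0 EV dV]]] := box_covered_nat cE (ltn0Sn _ : (0 < M)%N).
have DM0 : 0 < D / M%:R by rewrite divr_gt0.
pose ctr i := xget 0 (V i).
have ctrP i : I i -> V i (ctr i) by move=> /V0 /(xgetPex 0).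
apply: (@le_trans _ _ (\esum_(i in I) ((2 * (D / M%:R)) `^ lambda)%:E)).
  (* A set of diameter at most [D / M] lies in the open ball of twice that radius
     centred at any of its points. *)
  apply: ereal_inf_lbound; exists I, ctr, (fun=> 2 * (D / M%:R)); split=> //.
    by move=> i _; rewrite mulr_gt0.
  move=> y /EV[i Ii Vy]; exists i => //; rewrite /eball/=.
  have := dV _ _ _ Vy (ctrP _ Ii); lra.
apply: (@le_trans _ _ ((N * M ^ m)%:R * (2 * (D / M%:R)) `^ lambda)%:E).
  apply: esum_nat_le => //; first exact: powR_ge0.
  by move=> i _; rewrite !lee_fin powR_ge0/=.
rewrite lee_fin; suff -> : (N * M ^ m)%:R * (2 * (D / M%:R)) `^ lambda =
    c / M%:R `^ (lambda - m%:R) by [].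
rewrite mulrA powRM ?invr_ge0 ?mulr_ge0 ?(ltW D0) ?(ltW M0)//.
rewrite natrM natrX -powR_mulrn ?(ltW M0)// powRB; last by rewrite gt_eqF ?implybT.
rewrite -powR_inv1 ?(ltW M0)// -powRrM mulN1r powRN /c.
by field; rewrite !gt_eqF// powR_gt0.
Qed.

(** A piece of diameter at most [d] is mapped by its chart into a half-open cube of
side [3 * d] around the image of any of its points; cutting that cube cuts the
piece. The constant has [m.+1] instead of [m] in order to stay positive in
dimension zero, where the balls covering a point still need a positive radius. *)
Lemma has_chart_box_covered (R : realType) (n m N : nat) (K d : R)
    (E : 'I_N -> set 'rV[R]_n) :
  0 <= K -> 0 < d ->
  (forall a, has_chart m K (E a)) ->
  (forall a y z, E a y -> E a z -> enorm (y - z) <= d) ->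
  box_covered m N (K * (m.+1%:R * (3 * d))) (\bigcup_a E a).
Proof.
move=> K0 d0 chart diam M M0.
have hU a : exists U : 'I_(M ^ m) -> set 'rV[R]_n,
    E a `<=` \bigcup_p U p /\
    forall p y z, U p y -> U p z ->
      enorm (y - z) <= K * (m.+1%:R * (3 * d)) / M%:R.
  have [T [T1 TE]] := chart a.
  have [[y0 Ey0]|/nonemptyPn ->] := pselect (E a !=set0); last first.
    by exists (fun=> set0); split=> // y.
  have d3 : 0 < 3 * d by rewrite mulr_gt0.
  have [|c cP] := @vec_grid R _ m M (E a) (fun y i => T y 0 i)
      (fun i => T y0 0 i - d) (3 * d) M0 d3.
    move=> y Ey i; have := le_trans (T1 y y0 i) (diam _ _ _ Ey Ey0).
    rewrite ler_norml; lra.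
  exists (fun p => [set y | E a y /\ c y = p]); split.
    by move=> y Ey; exists (c y).
  move=> p y z [Ey cy] [Ez cz]; apply: (le_trans (TE _ _ Ey Ez)).
  rewrite -mulrA ler_wpM2l// -mulrA.
  apply: (@le_trans _ _ (m%:R * (3 * d / M%:R))).
    by apply: sumr_le_const => i; apply: cP => //; rewrite cy.
  by rewrite ler_wpM2r ?ler_nat// divr_ge0// ltW.
have /choice[U UP] := hU.
(* A cell is a pair of a piece and a subcube; [mxvec_cast] supplies the cardinality
   of the type of pairs. *)
pose idx (p : 'I_(N * M ^ m)) :=
  enum_val (cast_ord (esym (mxvec_cast N (M ^ m))) p).
exists (fun p => U (idx p).1 (idx p).2).
split=> [y [a _ Ey]|p y z]; last exact: (UP _).2.
have [p _ Uy] := (UP a).1 _ Ey.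
exists (cast_ord (mxvec_cast N (M ^ m)) (enum_rank (a, p))) => //.
by rewrite /idx cast_ordK enum_rankK.
Qed.

Lemma has_chart_rectifiable (R : realType) (n m N : nat) (K : R)
    (E : 'I_N -> set 'rV[R]_n) :
  0 <= K -> (forall a, has_chart m K (E a)) -> rectifiable m (\bigcup_a E a).
Proof.
move=> K0 chart.
have /choice[g gP] := fun a => has_chart_param K0 (chart a).
exists (fun k => oapp g (fun=> 0) (insub k : option 'I_N)); split=> [k|].
  case: insub => [a|]; first exact: (gP a).1.
  by exists 0 => u w; rewrite subrr enorm0 mul0r.
rewrite (_ : _ `\` _ = set0) ?hausdorff_measure0//.
apply/seteqP; split=> // y [[a _ Ey]]; apply; exists (nat_of_ord a) => //.
by rewrite valK; exact: (gP a).2.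
Qed.

(** * Cones at straight visible boundary points *)

Section Boundary.
Context {R : realType} {n : nat} (Omega : set 'rV[R]_n).

Lemma dbdry_ge0 y : 0 <= dbdry Omega y.
Proof.
have [[r Dr]|nD] := pselect ([set enorm (y - z) | z in bdry Omega] !=set0).
  by apply: lb_le_inf; [exists r | move=> _ [z _ <-]; exact: enorm_ge0].
by rewrite /dbdry (_ : [set _ | _ in _] = set0) ?inf0//; exact/nonemptyPn.
Qed.

Lemma dbdry_le y z : bdry Omega z -> dbdry Omega y <= enorm (y - z).
Proof.
move=> bz; apply: ge_inf; last by exists z.
by exists 0 => _ [w _ <-]; exact: enorm_ge0.
Qed.

(** The openness of [Omega] is in terms of the sup norm, which the Euclidean norm
dominates. *)
Lemma dbdry_gt0 x xi : open Omega -> Omega x -> bdry Omega xi ->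
  0 < dbdry Omega x.
Proof.
move=> oO Ox bxi; have [e /= e0 xe] : exists2 e : R, 0 < e & ball x e `<=` Omega.
  by have /nbhs_ballP[e e0 xe] := open_nbhs_nbhs (conj oO Ox); exists e.
apply: (lt_le_trans e0); apply: lb_le_inf.
  by exists (enorm (x - xi)); exists xi.
move=> _ [z [_ zi] <-]; rewrite leNgt; apply/negP => xze; apply: zi.
rewrite (iffLR (interior_id _) oO); apply: xe; split=> // i j.
rewrite [i]ord1 /ball/=; apply: le_lt_trans xze.
by have := ler_coord_enorm (x - z) j; rewrite !mxE.
Qed.

Variables (x : 'rV[R]_n) (alpha : R).

(** The cone at [xi] that misses the boundary. Only parameters near [xi] matter,
where the minimum of [t] and [1 - t] is the distance to [xi] relative to
[enorm (x - xi)]; here [s] stands for [1 - t]. *)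
Lemma str_bdry_cone xi eta s : 0 < s <= 1 / 2 ->
  str_bdry Omega x alpha xi -> bdry Omega eta ->
  alpha * s * enorm (x - xi) <= enorm (eta - xi - s *: (x - xi)).
Proof.
move=> /andP[s0 s1] [_ _ /(_ (1 - s))] h beta.
have {}h : alpha * s * enorm (x - xi) <= dbdry Omega (seg x xi (1 - s)).
  have := h ltac:(lra).
  by rewrite /Num.min ifF; [congr (_ <= _); ring | apply/negbTE; rewrite -leNgt; lra].
apply: (le_trans h); apply: (le_trans (dbdry_le _ beta)).
rewrite enormB (_ : _ - _ = eta - xi - s *: (x - xi))//.
by apply/rowP => i; rewrite /seg !mxE; ring.
Qed.

Hypothesis alpha01 : 0 < alpha <= 1.

(** If [eta] were above [xi] at height [h] in the direction [v], take in the cone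
at [xi] the point with parameter [s = h / r0], where [r0] is the distance from
[x] to the base point [xi0] that defines [v]. It differs from [xi + h *: v] only
by [s *: (xi0 - xi)], which is at most a quarter of [alpha * h]; as [eta] is
at distance at least three quarters of [alpha * h] from it, the horizontal
displacement from [xi] to [eta] is at least half of [alpha * h]. *)
Lemma cone_graph_like (d : R) (E : set 'rV[R]_n) xi0 :
  0 < d -> d <= enorm (x - xi0) ->
  E `<=` str_bdry Omega x alpha ->
  (forall xi eta, E xi -> E eta -> enorm (xi - eta) <= alpha / 4 * d) ->
  E xi0 ->
  graph_like (2 / alpha) ((enorm (x - xi0))^-1 *: (x - xi0)) E.
Proof.
move=> d0 dr0 ES diam E0; set r0 := enorm (x - xi0) in dr0 *; set v := _ *: _.
have r0_gt0 : 0 < r0 by exact: lt_le_trans dr0.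
have v1 : enorm v = 1.
  by rewrite enormZ gtr0_norm ?invr_gt0// mulVf// gt_eqF.
have rv : r0 *: v = x - xi0 by rewrite scalerA mulfV ?gt_eqF// scale1r.
have [a0 a1] := andP alpha01.
have up xi eta : E xi -> E eta ->
    dotv (eta - xi) v <= 2 / alpha * enorm (hproj v (eta - xi)).
  move=> Exi Eeta; set h := dotv _ v; set w := hproj _ _.
  have [hle0|h_gt0] := leP h 0.
    by rewrite (le_trans hle0)// mulr_ge0 ?enorm_ge0// divr_ge0// ltW.
  have hd : h <= alpha / 4 * d.
    apply: (le_trans (ler_norm _)); apply: (le_trans (ler_dotv_unit _ v1)).
    exact: diam.
  have ad : alpha * d <= d by rewrite ger_pMl.
  have hs : 0 < h / r0 <= 1 / 2.
    by rewrite divr_gt0//= ler_pdivrMr//; lra.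
  have := str_bdry_cone hs (ES _ Exi) (let: And3 b _ _ := ES _ Eeta in b).
  have -> : eta - xi - (h / r0) *: (x - xi) = w + (h / r0) *: (xi - xi0).
    rewrite -(hprojK v (eta - xi)) -/h -/w -addrA; congr (_ + _).
    have -> : xi - xi0 = r0 *: v - (x - xi).
      by rewrite rv; apply/rowP => i; rewrite !mxE; ring.
    by rewrite [in RHS]scalerBr [_ *: (r0 *: v)]scalerA divfK ?gt_eqF.
  move=> key; have := le_trans key (ler_enormD _ _).
  rewrite enormZ gtr0_norm; last by case/andP: hs.
  have r1 := ler_enorm_dist x xi xi0; rewrite -/r0 in r1.
  have r2 := diam _ _ Exi E0.
  set s := h / r0; have hE : h = s * r0 by rewrite /s divfK ?gt_eqF.
  set r := enorm (x - xi) in r1 *; set e := enorm (xi - xi0) in r1 r2 *.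
  have s0 : 0 < s by case/andP: hs.
  move=> k; rewrite mulrAC ler_pdivlMr// hE.
  have e4 : e <= alpha / 4 * r0.
    by apply: (le_trans r2); rewrite ler_wpM2l// divr_ge0// ltW.
  have aa : alpha * e <= e by rewrite ler_piMl ?enorm_ge0.
  have ar : alpha * r0 <= alpha * r + alpha * e by rewrite -mulrDr ler_wpM2l// ltW.
  have : s * (alpha / 2 * r0) <= s * (alpha * r - e).
    by rewrite ler_wpM2l ?(ltW s0)//; lra.
  lra.
(* Exchanging the two points changes the sign of the height. *)
move=> eta xi Eeta Exi; rewrite ler_norml up// andbT lerNl -dotvNl opprB.
apply: (le_trans (up _ _ Eeta Exi)).
by rewrite -(enormN (hproj _ _)) !hprojB opprB.
Qed.

End Boundary.

(** The set lies in a cube of side [2 * C0 * d], and the diameter of a subcube is at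
most [n] times its side; the number of subcubes makes this at most
[alpha / 4 * d]. It does not depend on the domain, because [d] cancels. *)
Lemma str_bdry_split (R : realType) (alpha C0 : R) (m : nat) :
  0 < alpha <= 1 -> 1 <= C0 ->
  exists N, forall (Omega : set 'rV[R]_m.+1) x, open Omega -> Omega x ->
    exists E : 'I_N -> set 'rV[R]_m.+1,
    [/\ str_bdry Omega x alpha `&` eball x (C0 * dbdry Omega x) = \bigcup_a E a,
      forall a y z, E a y -> E a z -> enorm (y - z) <= dbdry Omega x &
      forall a, exists v, enorm v = 1 /\ graph_like (2 / alpha) v (E a)].
Proof.
move=> a01 C01; have [a0 a1] := andP a01.
pose M := (Num.truncn (8 * m.+1%:R * C0 / alpha)).+1.
exists (M ^ m.+1)%N => Omega x oO Ox; set d := dbdry Omega x.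
set S := _ `&` _.
have unit1 : enorm (delta_mx 0 0 : 'rV[R]_m.+1) = 1.
  rewrite /enorm /dotv (bigD1 ord0)//= big1 ?addr0; last first.
    by move=> i i0; rewrite !mxE (negbTE i0) andbF mul0r.
  by rewrite !mxE !eqxx mul1r sqrtr1.
have [[y0 Sy0]|/nonemptyPn S0] := pselect (S !=set0); last first.
  exists (fun=> set0); split=> //; first by rewrite S0 bigcup0.
  by move=> a; exists (delta_mx 0 0); split=> // y.
have d0 : 0 < d by case: Sy0 => -[b _ _] _; exact: dbdry_gt0 b.
have l0 : 0 < 2 * (C0 * d) by rewrite !mulr_gt0//; lra.
have [|c cP] := @vec_grid R _ m.+1 M S (fun y i => y 0 i)
    (fun i => x 0 i - C0 * d) (2 * (C0 * d)) (ltn0Sn _) l0.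
  move=> y [_ /= yx] i; have := le_lt_trans (ler_coord_enorm (y - x) i) yx.
  rewrite !mxE ltr_norml -/d; lra.
pose E a := [set y | S y /\ c y = a].
have small a y z : E a y -> E a z -> enorm (y - z) <= alpha / 4 * d.
  move=> [Sy cy] [Sz cz]; rewrite (le_trans (ler_enorm_sum _))//.
  apply: (@le_trans _ _ (m.+1%:R * (2 * (C0 * d) / M%:R))).
    apply: sumr_le_const => i.
    by have := cP y z Sy Sz (etrans cy (esym cz)) i; rewrite !mxE.
  have hM : 8 * m.+1%:R * C0 / alpha < M%:R := truncnS_gt _.
  rewrite ltr_pdivrMr// in hM.
  rewrite mulrA ler_pdivrMr ?ltr0n//.
  have := ler_wpM2r (ltW d0) (ltW hM); lra.
exists E; split.
- by apply/seteqP; split=> [y Sy|y [a _ []]//]; exists (c y).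
- move=> a y z Ey Ez; rewrite (le_trans (small _ _ _ Ey Ez))//.
  rewrite ler_piMl ?(ltW d0)//; lra.
- move=> a; have [[xi0 E0]|/nonemptyPn ->] := pselect (E a !=set0); last first.
    by exists (delta_mx 0 0); split=> // y.
  have dE xi : E a xi -> d <= enorm (x - xi).
    by move=> [[[b _ _] _] _]; exact: dbdry_le.
  have r0 := lt_le_trans d0 (dE _ E0).
  exists ((enorm (x - xi0))^-1 *: (x - xi0)); split.
    by rewrite enormZ gtr0_norm ?invr_gt0// mulVf// gt_eqF.
  move=> y z Ey Ez.
  apply: (@cone_graph_like R _ Omega x alpha a01 d (E a)) => //; first exact: dE.
  - by move=> xi [[]].
  - exact: small.
Qed.

(** * Structure of the straight visible boundary *)

Theorem theorem1p1 (R : realType) (alpha : R) (halpha : 0 < alpha <= 1) :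
  exists L : R, 0 <= L /\
  forall (n : nat) (hn : (0 < n)%N) (C0 : R) (hC0 : 1 <= C0),
  exists (N : nat) (C : R),
  forall (Omega : set 'rV[R]_n) (x : 'rV[R]_n),
    domain Omega -> Omega <> setT -> Omega x ->
    let S := str_bdry Omega x alpha `&` eball x (C0 * dbdry Omega x) in
    [/\ exists G : 'I_N -> set 'rV[R]_n,
          (forall i, lipschitz_graph L (G i)) /\ S `<=` \bigcup_i G i,
        rectifiable n.-1 S,
        (hausdorff_measure (n.-1)%:R S <= (C * dbdry Omega x ^+ n.-1)%:E)%E &
        forall lambda : R, (n.-1)%:R < lambda ->
          hausdorff_content lambda S = 0%E].
Proof.
have L0 : 0 <= 2 / alpha by case/andP: halpha => a0 _; rewrite divr_ge0// ltW.
exists (2 / alpha); split=> // -[//|m] _ C0 C01; rewrite -[m.+1.-1]/m.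
have [N split_S] := str_bdry_split m halpha C01.
pose K := 2 * (1 + 2 / alpha).
have K0 : 0 < K by rewrite mulr_gt0//; lra.
exists N, (N%:R * (K * (m.+1%:R * 3)) ^+ m) => Omega x [_ oO _] _ Ox S.
have [E [SE diamE graphE]] := split_S Omega x oO Ox.
have charts a : has_chart m K (E a).
  by have [v [v1 Ev]] := graphE a; exact: graph_like_chart Ev.
set d := dbdry Omega x in diamE *.
(* Positivity of [d] is read off a boundary point, which a nonempty [S] provides. *)
have coverS : S = set0 \/
    0 < K * (m.+1%:R * (3 * d)) /\ box_covered m N (K * (m.+1%:R * (3 * d))) S.
  have [[y [[b _ _] _]]|/nonemptyPn S0] := pselect (S !=set0); last by left.
  have d0 : 0 < d := dbdry_gt0 oO Ox b.
  right; split; first by apply: mulr_gt0 => //; rewrite !mulr_gt0.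
  rewrite (SE : S = _); exact: has_chart_box_covered (ltW K0) d0 charts diamE.
split.
- exists E; split=> [a|]; last by rewrite -SE.
  by have [v [v1 Ev]] := graphE a; exact: graph_like_lipschitz Ev.
- rewrite (SE : S = _); exact: has_chart_rectifiable (ltW K0) charts.
- case: coverS => [->|[D0 cS]].
    rewrite hausdorff_measure0 lee_fin; have d0 : 0 <= d := dbdry_ge0 _ _.
    rewrite mulr_ge0 ?exprn_ge0// mulr_ge0// exprn_ge0//.
    by apply: mulr_ge0 (ltW K0) _; rewrite mulr_ge0.
  have -> : N%:R * (K * (m.+1%:R * 3)) ^+ m * d ^+ m =
      N%:R * (K * (m.+1%:R * (3 * d))) ^+ m by rewrite -mulrA -exprMn -!mulrA.
  exact: box_covered_measure (ltW D0) cS.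
- move=> lambda ml; case: coverS => [->|[D0 cS]].
    exact: box_covered_content ltr01 ml (box_covered0 _ _ _).
  exact: box_covered_content D0 ml cS.
Qed.
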